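(* Let $n\ge 2$ be an integer and let $m\in\mathbb{Z}$ be such that $f(x)=x^n-m\in\mathbb{Z}[x]$ is irreducible over $\mathbb{Q}$ and $\nu_p(m)<n$ for every prime $p$. Let $K=\mathbb{Q}(\alpha)$ be the number field generated by a complex root $\alpha$ of $f(x)$. Then $\mathbb{Z}[\alpha]$ is the ring of integers of $K$ if and only if $\nu_p(m^p-m)=1$ for every prime $p$ dividing $n\cdot m$.
   Context: For a prime $p$, $\nu_p$ denotes the $p$-adic valuation on $\mathbb{Q}$ (with $\nu_p(0)=\infty$). *)

(* Defs.v *)
From HB Require Import structures.
From mathcomp Require Import all_boot all_order all_algebra all_field.
From mathcomp Require Import constructive_ereal.

Set Implicit Arguments.
Unset Strict Implicit.
Unset Printing Implicit Defensive.

Import Order.TTheory GRing.Theory Num.Theory.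
Local Open Scope ring_scope.

(* The values live in [\bar int], so that the valuation of 0 is [+oo]; note
   that [logn p 0] is 0, hence the case distinction. Meaningful for [p] prime. *)
Definition padic_val (p : nat) (x : rat) : \bar int :=
  if x == 0 then +oo%E
  else ((logn p `|numq x|)%:Z - (logn p `|denq x|)%:Z)%:E.

Definition binom_poly (n : nat) (m : int) : {poly int} := 'X^n - m%:P.

(* [algC] is the field of algebraic complex numbers; it contains every complex
   root of a nonzero polynomial with integer coefficients. *)
Definition in_Z_adjoin (alpha x : algC) : Prop :=
  exists q : {poly int}, x = (map_poly intr q).[alpha].

Definition in_Q_adjoin (alpha x : algC) : Prop :=
  exists q r : {poly rat}, (map_poly ratr r).[alpha] != 0 /\
    x = (map_poly ratr q).[alpha] / (map_poly ratr r).[alpha].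

Definition in_ring_of_integers (K : algC -> Prop) (x : algC) : Prop :=
  K x /\ x \in Aint.

(* Main.v *)
(* Maximality of R = Z[alpha] is tested one prime p at a time.  If p does not
   divide n m, or if m^p - m is not divisible by p^2, there are w in R and e > 0
   such that w^e = p v with v a unit modulo P = (w, p), and some q > 1 such that
   a^q = a modulo P for every a in R, so that R/P is reduced.  Then an integral x
   with p x in R lies in R: p x is divisible by w^i modulo p R for i = 0, ..., e
   in turn, since the successive quotients are nilpotent modulo P.  Conversely,
   if p | n m and p^2 | m^p - m, an explicit integral element of (1/p) R lies
   outside R. *)

Require Import Defs.
From HB Require Import structures.
From mathcomp Require Import all_boot all_order all_algebra all_field.
From mathcomp Require Import constructive_ereal cyclic ring zify.

Set Implicit Arguments.
Unset Strict Implicit.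
Unset Printing Implicit Defensive.

Import Order.TTheory GRing.Theory Num.Theory.
Local Open Scope ring_scope.

(** * Powers of sums and Fermat congruences modulo p and p^2 *)

Lemma exprD_prime (A : comNzRingType) (p : nat) (a b : A) : prime p ->
  exists h, (a + b) ^+ p = a ^+ p + b ^+ p + p%:R * (a * b * h).
Proof.
case: p => [|[|p]] // p_pr.
rewrite addrC exprDn big_ord_recl big_ord_recr /= !subn0 subnn expr0 mulr1.
rewrite mul1r bin0 binn !mulr1n.
suff [h ->] : exists h, \sum_(i < p.+1)
    b ^+ (p.+2 - bump 0 i) * a ^+ bump 0 i *+ 'C(p.+2, bump 0 i)
  = p.+2%:R * (a * b * h) by exists h; ring.
apply: (big_ind (fun s => exists h, s = p.+2%:R * (a * b * h))).
- by exists 0; rewrite !mulr0.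
- by move=> _ _ [h ->] [k ->]; exists (h + k); ring.
move=> i _; rewrite /bump add1n.
have /dvdnP[d ->] : (p.+2 %| 'C(p.+2, i.+1))%N.
  by apply: prime_dvd_bin => //; rewrite ltnS /= ltnS ltn_ord.
have -> : (p.+2 - i.+1 = (p - i).+1)%N by have := ltn_ord i; lia.
exists (b ^+ (p - i) * a ^+ i * d%:R).
by rewrite -mulr_natr natrM !exprS; ring.
Qed.

(** The error term keeps the factor [a]: for [a] = [w] it stays in (w, p) even after division by
    p. *)
Lemma exprD_prime_exp (A : comNzRingType) (p k : nat) (a b : A) : prime p ->
  exists h, (a + b) ^+ (p ^ k) = a ^+ (p ^ k) + b ^+ (p ^ k) + p%:R * (a * h).
Proof.
move=> p_pr; elim: k => [|k [h IH]].
  by exists 0; rewrite !expn0 !expr1; ring.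
rewrite expnSr !exprM IH.
set x := a ^+ (p ^ k); set y := b ^+ (p ^ k).
have [h1 ->] := exprD_prime (x + y) (p%:R * (a * h)) p_pr.
have [h2 ->] := exprD_prime x y p_pr.
have [x' Dx] : exists x', x = a * x'.
  have pk0 : (0 < p ^ k)%N by rewrite expn_gt0 prime_gt0.
  by exists (a ^+ (p ^ k).-1); rewrite -exprS prednK.
have [z ->] : exists z, (p%:R * (a * h)) ^+ p = p%:R * (a * h) * z.
  by exists ((p%:R * (a * h)) ^+ p.-1); rewrite -exprS prednK ?prime_gt0.
exists (x' * y * h2 + h * z + (x + y) * (p%:R * h) * h1).
set xp := x ^+ p; rewrite Dx; ring.
Qed.

Lemma fermat_int (p : nat) (a : int) : prime p -> (p%:Z %| a ^+ p - a)%Z.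
Proof.
move=> p_pr.
have step (b : int) : exists h, (b + 1) ^+ p - (b + 1) = b ^+ p - b + h * p%:Z.
  have [h ->] := exprD_prime b 1 p_pr; exists (b * h); rewrite expr1n pmulrn intz.
  by ring.
elim/int_rect: a => [|k IH|k IH].
- by rewrite expr0n gtn_eqF ?prime_gt0 // subr0 dvdz0.
- have [h] := step k%:Z; have -> : k%:Z + 1 = k.+1%:Z by lia.
  by move=> ->; rewrite rpredD // dvdz_mull.
- have [h] := step (- k.+1%:Z).
  have -> : - k.+1%:Z + 1 = - k%:Z by lia.
  move=> E; have -> : (- k.+1%:Z) ^+ p - - k.+1%:Z =
     ((- k%:Z) ^+ p - - k%:Z) + (- h) * p%:Z by rewrite E; ring.
  by rewrite rpredD // dvdz_mull.
Qed.

Lemma fermat_int_exp (p k : nat) (a : int) :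
  prime p -> (p%:Z %| a ^+ (p ^ k) - a)%Z.
Proof.
move=> p_pr; elim: k => [|k IH]; first by rewrite subrr dvdz0.
rewrite expnSr exprM.
have := rpredD (fermat_int (a ^+ (p ^ k)) p_pr) IH.
by rewrite addrA subrK.
Qed.

(** If x = y modulo p, then x^p = y^p modulo p^2; this is applied to x = a^(p^(k+1)) and y =
    a^(p^k). It lets a hypothesis on m^p - m control m^(p^(k+1)) - m. *)
Lemma fermat_exp_mod_sq (p k : nat) (a : int) : prime p ->
  (p%:Z ^+ 2 %| a ^+ (p ^ k.+1) - a ^+ p)%Z.
Proof.
move=> p_pr; elim: k => [|k IH]; first by rewrite expn1 subrr dvdz0.
suff H : (p%:Z ^+ 2 %| a ^+ (p ^ k.+2) - a ^+ (p ^ k.+1))%Z.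
  by have := rpredD H IH; rewrite addrA subrK.
have /dvdzP[z] := fermat_int (a ^+ (p ^ k)) p_pr.
rewrite -exprM -expnSr; move/eqP; rewrite subr_eq addrC => /eqP E.
rewrite (expnSr p k.+1) exprM {1}E (expnSr p k) exprM.
have [h ->] := exprD_prime (a ^+ (p ^ k)) (z * p%:Z) p_pr.
have [t ->] : exists t, (z * p%:Z) ^+ p = (z * p%:Z) ^+ 2 * t.
  by exists ((z * p%:Z) ^+ (p - 2)); rewrite -exprD subnKC // prime_gt1.
apply/dvdzP; exists (z ^+ 2 * t + a ^+ (p ^ k) * z * h).
rewrite !natz; ring.
Qed.

(** * A local criterion for an integral element to lie in the image of a ring *)

Section LocalCriterion.

Variables (A : comNzRingType) (F : fieldType) (ev : {rmorphism A -> F}).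
Variables (p : nat) (w : A).

(* The preimage under [ev] of the ideal [(ev w, p)] of the image of [ev]. *)
Definition in_ideal (a : A) : Prop :=
  exists b c, ev a = ev (w * b + p%:R * c).

Lemma in_idealD a b : in_ideal a -> in_ideal b -> in_ideal (a + b).
Proof.
move=> [c [d E]] [c' [d' E']]; exists (c + c'), (d + d').
by rewrite rmorphD E E' -rmorphD; congr (ev _); ring.
Qed.

Lemma in_idealM a b : in_ideal a -> in_ideal (a * b).
Proof.
move=> [c [d E]]; exists (c * b), (d * b).
by rewrite rmorphM E -rmorphM; congr (ev _); ring.
Qed.

Lemma in_ideal_trans b a c :
  in_ideal (a - b) -> in_ideal (b - c) -> in_ideal (a - c).
Proof. by move=> ab bc; have := in_idealD ab bc; rewrite addrA subrK. Qed.

Lemma in_ideal_sym a b : in_ideal (a - b) -> in_ideal (b - a).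
Proof. by move=> /(in_idealM (-1)); rewrite mulrN1 opprB. Qed.

Lemma in_ideal_natl c : in_ideal (p%:R * c).
Proof. by exists 0, c; rewrite mulr0 add0r. Qed.

Lemma in_ideal_genl b : in_ideal (w * b).
Proof. by exists b, 0; rewrite mulr0 addr0. Qed.

Lemma in_ideal_ker a b : ev a = ev b -> in_ideal (a - b).
Proof.
by move=> E; exists 0, 0; rewrite !mulr0 addr0 rmorphB E subrr rmorph0.
Qed.

Lemma in_ideal_exp k a b : in_ideal (a - b) -> in_ideal (a ^+ k - b ^+ k).
Proof. by rewrite subrXX; apply: in_idealM. Qed.

Lemma in_ideal_mul a a' b b' :
  in_ideal (a - a') -> in_ideal (b - b') -> in_ideal (a * b - a' * b').
Proof.
move=> /(in_idealM b) Ha /(in_idealM a') Hb.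
by have := in_idealD Ha Hb; congr in_ideal; ring.
Qed.

(* Iterating [a = a^q] gives [a = a^(q^k)], a multiple of [a^k]. *)
Lemma in_ideal_reduced q a k : (1 < q)%N -> in_ideal (a ^+ q - a) ->
  in_ideal (a ^+ k) -> in_ideal a.
Proof.
move=> q_gt1 aq ak.
have aqi i : in_ideal (a ^+ (q ^ i) - a).
  elim: i => [|i IH]; first by apply: in_ideal_ker; rewrite expn0 expr1.
  apply: in_ideal_trans IH.
  by rewrite expnS exprM; apply: in_ideal_exp.
have lt : (k <= q ^ k)%N by rewrite ltnW // ltn_expl.
have /(in_idealM (a ^+ (q ^ k - k))) := ak.
rewrite -exprD subnKC // => aqk.
have := in_idealD aqk (in_ideal_sym (aqi k)).
by rewrite addrC subrK.
Qed.

(** Multiply a monic equation of degree N for x by w^(d N): it becomes t^N plus terms P_i w^(d (N -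
    i)) t^i with i < N, all multiples of [w] as d > 0. *)
Lemma integral_multiple_nilpotent d t x : (0 < d)%N ->
  integralOver ev x -> ev t = ev (w ^+ d) * x ->
  exists N, in_ideal (t ^+ N).
Proof.
move=> d0 [P P_monic /rootP Px] Dt.
exists (size P).-1; pose N := (size P).-1.
have sizeP : size P = N.+1 by rewrite /N prednK // size_poly_gt0 monic_neq0.
have le_sP : (size (map_poly ev P) <= N.+1)%N by rewrite -sizeP size_poly.
move: Px; rewrite (horner_coef_wide _ le_sP) big_ord_recr /= coef_map /=.
have -> : P`_N = 1 by move/monicP: P_monic; rewrite lead_coefE.
rewrite rmorph1 mul1r => /(congr1 ( *%R (ev (w ^+ d) ^+ N))).
rewrite mulr0 mulrDr -exprMn -Dt -[ev t ^+ N]rmorphXn => E.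
suff [c Dc] : exists c, ev (w ^+ d) ^+ N *
    (\sum_(i < N) (map_poly ev P)`_i * x ^+ i) = ev (w * c).
  rewrite Dc in E; exists (- c), 0.
  apply/eqP; rewrite mulr0 addr0 mulrN rmorphN -addr_eq0 addrC; exact/eqP.
rewrite mulr_sumr.
apply: (big_ind (fun s => exists c, s = ev (w * c))).
- by exists 0; rewrite mulr0 rmorph0.
- by move=> _ _ [b ->] [c ->]; exists (b + c); rewrite -rmorphD mulrDr.
move=> i _; rewrite coef_map.
exists (w ^+ d.-1 * (w ^+ d) ^+ (N - i).-1 * P`_i * t ^+ i).
have Ni : (0 < N - i)%N by rewrite subn_gt0.
rewrite [w * _]mulrA [w * _]mulrA [w * _]mulrA -exprS prednK //.
rewrite !rmorphM [ev (t ^+ i)]rmorphXn Dt exprMn [ev (_ ^+ (N - i).-1)]rmorphXn.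
have -> : ev (w ^+ d) ^+ N = ev (w ^+ d) ^+ ((N - i).-1.+1 + i)%N.
  by rewrite prednK // subnK // ltnW.
rewrite exprD exprS; ring.
Qed.

(* By induction on [i], [p x = ev (w^i y)] after subtracting an element of the
   image of [ev] from [x]: as [ev (v y) = ev (w^(e-i)) x] with [x] integral, [v y]
   is nilpotent modulo [(w, p)].  At [i = e] one gets [x = ev (v y)]. *)
Lemma integral_in_image q e v u x :
  (1 < q)%N -> (forall a, in_ideal (a ^+ q - a)) ->
  (p%:R : F) != 0 -> (0 < e)%N ->
  ev (w ^+ e) = ev (p%:R * v) -> in_ideal (v * u - 1) ->
  integralOver ev x ->
  (exists y, p%:R * x = ev y) -> exists y, x = ev y.
Proof.
move=> q_gt1 fixed p0 e0 we vu x_int [y0 Dy0].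
have evp : ev p%:R = p%:R by rewrite rmorph_nat.
(* If [ev w] = 0, then [ev v] = 0 too, so [vu] reads -1 = p c in the image, where p is therefore
   invertible. *)
have [w0|w0] := eqVneq (ev w) 0.
  have v0 : ev v = 0.
    move: we; rewrite rmorphXn w0 expr0n gtn_eqF // rmorphM evp => /esym/eqP.
    by rewrite mulf_eq0 (negPf p0) => /eqP.
  have [b [c]] := vu; rewrite rmorphB !rmorphD !rmorphM v0 w0 rmorph1 evp.
  rewrite !mul0r !add0r => E.
  exists (- (y0 * c)).
  rewrite rmorphN rmorphM -Dy0; transitivity (- (-1 * x)); first by ring.
  by rewrite E; ring.
have claim i : (i <= e)%N -> exists z y, p%:R * (x - ev z) = ev (w ^+ i * y).
  elim: i => [_|i IH lt_ie].
    by exists 0, y0; rewrite rmorph0 subr0 expr0 mul1r.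
  have [z [y E]] := IH (ltnW lt_ie).
  have [b [c Dy]] : in_ideal y.
    have Dyv : ev (y * v) = ev (w ^+ (e - i)) * (x - ev z).
      apply: (mulfI p0); rewrite mulrCA E -rmorphM mulrA -exprD subnK ?(ltnW lt_ie) //.
      by rewrite [RHS]rmorphM we -evp -!rmorphM; congr (ev _); ring.
    have xz_int : integralOver ev (x - ev z) by exact/integral_sub/integral_id.
    have ei0 : (0 < e - i)%N by rewrite subn_gt0.
    have [N yvN] := integral_multiple_nilpotent ei0 xz_int Dyv.
    have yv := in_ideal_reduced q_gt1 (fixed _) yvN.
    (* y = (y v) u - y (v u - 1). *)
    have := in_idealD (in_idealM u yv) (in_idealM (- y) vu).
    by congr in_ideal; ring.
  (* p (x - z) = w^i y = w^(i+1) b + p w^i c, so w^i c is moved into z. *)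
  exists (z + w ^+ i * c), b.
  rewrite rmorphD opprD addrA mulrDr E rmorphM Dy.
  rewrite mulrN -evp -!rmorphM -rmorphB exprSr; congr (ev _); ring.
have [z [y E]] := claim e (leqnn e).
exists (z + v * y).
apply/eqP; rewrite rmorphD addrC -subr_eq; apply/eqP/(mulfI p0).
by rewrite E rmorphM we -evp -!rmorphM; congr (ev _); ring.
Qed.

End LocalCriterion.

(** * Algebraic integers, inverses modulo p and valuations *)

Lemma exprB_factor (A : comNzRingType) (a : A) k :
  (0 < k)%N -> a ^+ k - a = a * (a ^+ k.-1 - 1).
Proof. by move=> k0; rewrite mulrBr mulr1 -exprS prednK. Qed.

(** [Aint] tests the minimal polynomial, while the criterion above accepts any monic equation. *)
Lemma Aint_integralOver (x : algC) :
  x \in Aint <-> integralOver (intr : int -> algC) x.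
Proof.
split=> [|[P P_monic Px]].
  rewrite unfold_in => /floorpP[P DP]; exists P.
    apply/monicP/(@intr_inj algC).
    rewrite -(lead_coef_map_inj (@intr_inj algC)) ?rmorph0 //.
    by rewrite -DP; apply/monicP/minCpoly_monic.
  by rewrite -DP root_minCpoly.
apply: root_monic_Aint Px _ _; first exact: monic_map.
by apply/polyOverP=> i; rewrite coef_map /= intr_int.
Qed.

Lemma Bezout_prime (p : nat) (c : int) : prime p -> ~~ (p%:Z %| c)%Z ->
  exists u, (p%:Z %| c * u - 1)%Z.
Proof.
move=> p_pr pc.
have : coprimez p%:Z c by rewrite coprimezE prime_coprime.
case/coprimezP=> [[a u] /= E]; exists u; apply/dvdzP; exists (- a).
by rewrite -E; ring.
Qed.

Lemma padic_val_int_eq1 (p : nat) (z : int) : prime p ->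
  padic_val p z%:~R = 1%:E <->
  (p%:Z %| z)%Z && ~~ (p%:Z ^+ 2 %| z)%Z.
Proof.
move=> p_pr; rewrite /padic_val intr_eq0 numq_int denq_int /= logn1 subr0.
(* The valuation of 0 is [+oo] and p^2 divides 0: both sides are false. *)
have [->|z0] := eqVneq z 0; first by rewrite !dvdz0.
have z_gt0 : (0 < `|z|)%N by rewrite absz_gt0.
rewrite !dvdzE abszX /= -[X in (X %| _)%N]expn1 !pfactor_dvdn // -ltnNge ltnS.
by rewrite -eqn_leq; split=> [[->] //|/eqP <-].
Qed.

(** * Maximality of Z[alpha] at one prime *)

Section Binomial.

Variables (n : nat) (m : int) (alpha : algC).
Hypothesis n_gt0 : (0 < n)%N.
Hypothesis alphaXn : alpha ^+ n = m%:~R.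

(** Z[alpha] is represented as the image of this morphism, so that its elements are handled through
    integer polynomials. *)
Definition eval_at : {rmorphism {poly int} -> algC} :=
  horner_eval alpha \o map_poly intr.

Lemma eval_atC c : eval_at c%:P = c%:~R.
Proof. by rewrite /eval_at /= map_polyC /horner_eval hornerC. Qed.

Lemma eval_atX : eval_at 'X = alpha.
Proof. by rewrite /eval_at /= map_polyX /horner_eval hornerX. Qed.

Lemma in_idealC p w (c : int) :
  (p%:Z %| c)%Z -> in_ideal eval_at p w c%:P.
Proof.
move=> /dvdzP[z ->]; have := in_ideal_natl eval_at p w z%:P.
by congr in_ideal; rewrite mulrC rmorphM /= -natz rmorph_nat.
Qed.

(** Modulo p, raising to the power p^j is additive and fixes the integers, so the generator [X]
    decides. *)
Lemma in_ideal_Frobenius_fixed p w j : prime p ->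
  in_ideal eval_at p w ('X ^+ (p ^ j) - 'X) ->
  forall a, in_ideal eval_at p w (a ^+ (p ^ j) - a).
Proof.
move=> p_pr fixX a; elim/poly_ind: a => [|a c IH].
  rewrite expr0n subr0 gtn_eqF ?expn_gt0 ?prime_gt0 //.
  by have := in_ideal_natl eval_at p w 0; rewrite mulr0.
have [h ->] := exprD_prime_exp j (a * 'X) c%:P p_pr.
have H1 := in_ideal_mul IH fixX.
have := in_idealC w (fermat_int_exp j c p_pr).
rewrite rmorphB rmorphXn /= => H2.
have H3 := in_ideal_natl eval_at p w (a * 'X * h).
have := in_idealD (in_idealD H1 H2) H3.
by rewrite exprMn; congr in_ideal; ring.
Qed.

(* As [p] is prime to [l (p - 1)], some power satisfies [p^j = 1 + l (p - 1) t],
   and [X^(l (p - 1)) = m^(p - 1) = 1] modulo [p] and [X^l - m]. *)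
Lemma in_ideal_Xn_fixed p w l : prime p -> coprime p l -> ~~ (p%:Z %| m)%Z ->
  in_ideal eval_at p w ('X ^+ l - m%:P) ->
  exists2 j, (0 < j)%N & in_ideal eval_at p w ('X ^+ (p ^ j) - 'X).
Proof.
move=> p_pr pl pm Xl; pose d := (l * p.-1)%N.
have p_gt1 := prime_gt1 p_pr.
have l0 : (0 < l)%N.
  by case: l pl {Xl d} => //; rewrite /coprime gcdn0 gtn_eqF.
have d0 : (0 < d)%N by rewrite muln_gt0 l0 /= -subn1 subn_gt0.
exists (totient d); first by rewrite totient_gt0.
have pd : coprime p d.
  rewrite coprimeMr pl /= prime_coprime // gtnNdvd //; first by lia.
  by rewrite prednK // ltnW.
have /eqP := Euler_exp_totient pd.
rewrite eqn_mod_dvd ?expn_gt0 ?prime_gt0 // => /dvdnP[t].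
move=> Et; have -> : (p ^ totient d = t * d + 1)%N.
  by rewrite -Et subnK // expn_gt0 prime_gt0.
have [u Du] : exists u, m ^+ p.-1 - 1 = u * p%:Z.
  apply/dvdzP; have := fermat_int m p_pr.
  rewrite exprB_factor ?prime_gt0 // Gauss_dvdzr //.
  by rewrite coprimezE prime_coprime.
have H1 := in_ideal_exp (p.-1 * t) Xl.
have H2 : in_ideal eval_at p w (m%:P ^+ (p.-1 * t) - 1 ).
  rewrite -rmorphXn -[1]/(1%:P) -rmorphB; apply: in_idealC.
  rewrite exprM subrX1; apply: dvdz_mulr.
  by rewrite Du dvdz_mull.
have := in_idealM 'X (in_ideal_trans H1 H2).
rewrite mulrBl mul1r -exprM -exprSr addn1.
by congr (in_ideal _ _ _ ('X ^+ _.+1 - _)); rewrite /d; lia.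
Qed.

Lemma eval_at_Xn : eval_at ('X ^+ n) = eval_at m%:P.
Proof. by rewrite rmorphXn eval_atX eval_atC. Qed.

(* The element [w] with [w^e] equal to [p] up to a unit at [p] is: [X], with
   [e = n], if [p | m]; [p] itself if [p] does not divide [n m]; and [X^l - m],
   with [e = p^k], if [p] does not divide [m] and [n = l p^k], [k > 0], [l] prime
   to [p]. *)
Lemma adjoin_maximal_at (p : nat) (x : algC) : prime p ->
  ((p%:Z %| n%:Z * m)%Z -> ~~ (p%:Z ^+ 2 %| m ^+ p - m)%Z) ->
  x \in Aint -> (exists y, p%:R * x = eval_at y) -> exists y, x = eval_at y.
Proof.
move=> p_pr Hp xA px.
have p_gt1 := prime_gt1 p_pr.
have p0 : (p%:R : algC) != 0 by rewrite pnatr_eq0 -lt0n prime_gt0.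
have x_int : integralOver eval_at x.
  have /Aint_integralOver [P P_monic Px] := xA.
  exists (map_poly polyC P); first exact: monic_map.
  by rewrite -map_poly_comp (eq_map_poly eval_atC).
have pCE : p%:R = p%:Z%:P :> {poly int} by rewrite -natz rmorph_nat.
have dvd_nm : (p%:Z %| n%:Z * m)%Z = (p %| n)%N || (p%:Z %| m)%Z.
  by rewrite !dvdzE abszM Euclid_dvdM.
have [pm|pm] := boolP (p%:Z %| m)%Z.
  have /Hp : (p%:Z %| n%:Z * m)%Z by rewrite dvd_nm pm orbT.
  case/dvdzP: (pm) => c Dm; move=> Hm.
  (* If p^2 | m, then p^2 divides m (m^(p-1) - 1) = m^p - m. *)
  have pc : ~~ (p%:Z %| c)%Z.
    apply: contra Hm => /dvdzP[d Dc].
    have m2 : (p%:Z ^+ 2 %| m)%Z by rewrite Dm Dc -mulrA -expr2 dvdz_mull.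
    by rewrite exprB_factor ?prime_gt0 // dvdz_mulr.
  have [u Hu] := Bezout_prime p_pr pc.
  apply: (@integral_in_image _ _ eval_at p 'X (p ^ 1) n c%:P u%:P) => //.
  - apply: in_ideal_Frobenius_fixed => //.
    by rewrite expn1 exprB_factor ?prime_gt0 //; apply: in_ideal_genl.
  - by rewrite eval_at_Xn Dm pCE -rmorphM mulrC.
  - by rewrite -rmorphM -[1]/(1%:P) -rmorphB; apply: in_idealC.
have [pn|pn] := boolP (p %| n)%N; last first.
  have [j j0 fixX] : exists2 j, (0 < j)%N &
      in_ideal eval_at p p%:R ('X ^+ (p ^ j) - 'X).
    apply: (@in_ideal_Xn_fixed _ _ n); rewrite ?prime_coprime //.
    exact/in_ideal_ker/eval_at_Xn.
  apply: (@integral_in_image _ _ eval_at p p%:R (p ^ j) 1 1 1) => //.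
  - by rewrite -(expn0 p) ltn_exp2l.
  - exact: in_ideal_Frobenius_fixed.
  - by rewrite expr1 mulr1.
  - by rewrite mulr1; apply: in_ideal_ker.
have /Hp Hm : (p%:Z %| n%:Z * m)%Z by rewrite dvd_nm pn.
have [l pl Dn] := pfactor_coprime p_pr n_gt0.
have [k Dk] : exists k, logn p n = k.+1.
  by exists (logn p n).-1; rewrite prednK // logn_gt0 mem_primes p_pr n_gt0.
rewrite Dk in Dn; pose w : {poly int} := 'X ^+ l - m%:P.
have /dvdzP[c Dc] := fermat_int_exp k.+1 m p_pr.
(* As m^(p^(k+1)) = m^p modulo p^2, p | c would give p^2 | m^p - m. *)
have pc : ~~ (p%:Z %| c)%Z.
  apply: contra Hm => /dvdzP[d Dc'].
  have H2 : (p%:Z ^+ 2 %| m ^+ (p ^ k.+1) - m)%Z.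
    by rewrite Dc Dc' -mulrA -expr2 dvdz_mull.
  by have := rpredB H2 (fermat_exp_mod_sq k m p_pr); congr (_ %| _)%Z; ring.
have [u Hu] := Bezout_prime p_pr pc.
have [j j0 fixX] : exists2 j, (0 < j)%N &
    in_ideal eval_at p w ('X ^+ (p ^ j) - 'X).
  apply: (@in_ideal_Xn_fixed _ _ l) => //.
  by have := in_ideal_genl eval_at p w 1; rewrite mulr1.
have [h Dh] := exprD_prime_exp k.+1 w m%:P p_pr.
(* At alpha, m = (w + m)^(p^(k+1)) = w^(p^(k+1)) + m + p (c + w h), whence v = -(c + w h); modulo
   (w, p) this is -c, with inverse -u. *)
apply: (@integral_in_image _ _ eval_at p w (p ^ j) (p ^ k.+1)
          (- (c%:P + w * h)) (- u%:P)) => //.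
- by rewrite -(expn0 p) ltn_exp2l.
- exact: in_ideal_Frobenius_fixed.
- by rewrite expn_gt0 prime_gt0.
- have := eval_at_Xn; rewrite {1}Dn exprM -[_ ^+ l](subrK m%:P) Dh.
  move=> /eqP; rewrite -subr_eq0 -rmorphB => /eqP E.
  apply/eqP; rewrite -subr_eq0 -rmorphB -E.
  have -> : m%:P ^+ (p ^ k.+1) = m%:P + c%:P * p%:R.
    by rewrite pCE -rmorphM -Dc -rmorphXn -rmorphD addrC subrK.
  by apply/eqP; congr (eval_at _); ring.
have H1 : in_ideal eval_at p w (c%:P * u%:P - 1).
  by rewrite -rmorphM -[1]/(1%:P) -rmorphB; apply: in_idealC.
have := in_idealD H1 (in_ideal_genl eval_at p w (h * u%:P)).
by congr in_ideal; ring.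
Qed.

End Binomial.

(** * Irreducible binomials: coordinates in Z[alpha] and denominators in K *)

Lemma irredp_coprimep_or_dvdp (F : fieldType) (p q : {poly F}) :
  irreducible_poly p -> coprimep p q \/ p %| q.
Proof.
move=> p_irr; have [co|co] := boolP (coprimep p q); [by left | right].
by rewrite -(eqp_dvdl _ (p_irr.2 _ co (dvdp_gcdl p q))) dvdp_gcdr.
Qed.

Section IrreducibleBinomial.

Variables (n : nat) (m : int) (alpha : algC).
Hypothesis n_gt0 : (0 < n)%N.
Let fQ : {poly rat} := map_poly intr (binom_poly n m).
Hypothesis f_irr : irreducible_poly fQ.
Hypothesis f_alpha : root (map_poly intr (binom_poly n m)) alpha.

Lemma map_ratr_intr (g : {poly int}) :
  map_poly ratr (map_poly intr g : {poly rat}) = map_poly intr g :> {poly algC}.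
Proof. by rewrite -map_poly_comp; apply: eq_map_poly => a; apply: ratr_int. Qed.

Lemma binom_poly_monic : binom_poly n m \is monic.
Proof. exact: monicXnsubC. Qed.

Lemma size_binom_poly : size (binom_poly n m) = n.+1.
Proof. exact: size_XnsubC. Qed.

Lemma root_binom_expn : alpha ^+ n = m%:~R.
Proof.
apply/eqP; rewrite -subr_eq0; have := f_alpha.
rewrite /root /binom_poly rmorphB /= map_polyXn map_polyC.
by rewrite hornerD hornerN hornerXn hornerC.
Qed.

(** Coprimality over Q persists over [algC], where the common root alpha forbids it. *)
Lemma root_alpha_dvdp (r : {poly rat}) : root (map_poly ratr r) alpha -> fQ %| r.
Proof.
move=> r0; have [co|//] := irredp_coprimep_or_dvdp r f_irr.
move: co; rewrite -(coprimep_map (ratr : {rmorphism rat -> algC})) map_ratr_intr.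
by move=> co; have := coprimep_root co f_alpha; rewrite (rootP r0) eqxx.
Qed.

Lemma eval_at_eq0 (g : {poly int}) :
  eval_at alpha g = 0 -> (size g <= n)%N -> g = 0.
Proof.
move=> g0 sg.
have : root (map_poly ratr (map_poly intr g : {poly rat})) alpha.
  by rewrite map_ratr_intr; apply/rootP.
move/root_alpha_dvdp=> fg; apply: contraTeq fg => gn0.
have s_int (h : {poly int}) : size (map_poly intr h : {poly rat}) = size h.
  by apply: size_map_inj_poly => //; apply: intr_inj.
apply: contraL sg => /dvdp_leq; rewrite -size_poly_eq0 !s_int size_poly_eq0.
by move/(_ gn0); rewrite size_binom_poly -ltnNge.
Qed.

(** Reduce q modulo the monic f to some r of size at most n; then g - p r vanishes at alpha, hence
    is 0, since 1, ..., alpha^(n-1) are independent. *)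
Lemma dvdz_coef_eval_at (p : nat) (g q : {poly int}) (i : nat) :
  (size g <= n)%N -> eval_at alpha g = p%:R * eval_at alpha q ->
  (p%:Z %| g`_i)%Z.
Proof.
move=> sg E.
have f0 : eval_at alpha (binom_poly n m) = 0 by exact/rootP.
pose r := Pdiv.Ring.rmodp q (binom_poly n m).
have Er : eval_at alpha q = eval_at alpha r.
  rewrite {1}(Pdiv.RingMonic.rdivp_eq binom_poly_monic q) rmorphD rmorphM f0.
  by rewrite mulr0 add0r.
have sr : (size r <= n)%N.
  rewrite -ltnS -size_binom_poly Pdiv.Ring.ltn_rmodpN0 //.
  exact/monic_neq0/binom_poly_monic.
have : g - p%:Z%:P * r = 0.
  apply: eval_at_eq0.
    by rewrite rmorphB rmorphM eval_atC -Er E pmulrn subrr.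
  rewrite mul_polyC (leq_trans (size_polyD _ _)) // size_polyN geq_max sg.
  exact: leq_trans (size_scale_leq _ _) sr.
move/eqP; rewrite subr_eq0 => /eqP ->.
by rewrite mul_polyC coefZ dvdz_mulr.
Qed.

(** A Bezout relation u f + v r = c inverts r(alpha) as v(alpha) / c; then the coefficients of q v /
    c are put over a common denominator. *)
Lemma in_Q_adjoin_clear_denom x : in_Q_adjoin alpha x ->
  exists (d : nat) (g : {poly int}), (0 < d)%N /\ d%:R * x = eval_at alpha g.
Proof.
move=> [q [r [r0 Dx]]].
have [co|fr] := irredp_coprimep_or_dvdp r f_irr; last first.
  case/dvdpP: fr r0 => s ->; rewrite rmorphM /= map_ratr_intr hornerM.
  by rewrite (rootP f_alpha) mulr0 eqxx.
have /Bezout_coprimepP[[u v] /= uv] := co.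
have [c c0 Dc] : exists2 c, c != 0 & u * fQ + v * r = c%:P.
  by move: uv; rewrite -size_poly_eq1 => /size_poly1P.
have Ec : (map_poly ratr v).[alpha] * (map_poly ratr r).[alpha] = ratr c.
  have := congr1 (fun s => (map_poly (ratr : rat -> algC) s).[alpha]) Dc.
  rewrite rmorphD !rmorphM /= map_ratr_intr map_polyC hornerC hornerD !hornerM.
  by rewrite (rootP f_alpha) mulr0 add0r.
have [g [a a0 Dg]] := rat_poly_scale (c^-1 *: (q * v)).
(* The denominator a may be negative, so its sign goes to g. *)
exists `|a|%N, ((sgz a) *: g); rewrite absz_gt0; split=> //.
have -> : x = (map_poly ratr (c^-1 *: (q * v))).[alpha].
  rewrite Dx map_polyZ hornerZ rmorphM hornerM fmorphV /= -Ec.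
  have v0 : (map_poly ratr v).[alpha] != 0 :> algC.
    apply: contra_neq c0 => v0; apply/eqP.
    by rewrite -(fmorph_eq0 (ratr : {rmorphism rat -> algC})) /= -Ec v0 mul0r.
  by field; rewrite r0.
rewrite Dg map_polyZ hornerZ map_ratr_intr fmorphV /= ratr_int.
rewrite -[RHS]/(eval_at alpha (sgz a *: g)) -mul_polyC rmorphM eval_atC.
have aR : a%:~R != 0 :> algC by rewrite intr_eq0.
have -> : `|a|%N%:R = (sgz a)%:~R * a%:~R :> algC.
  by rewrite -intrM -abszEsg pmulrn.
by rewrite -mulrA mulVKf.
Qed.

(** Strong induction on a denominator d of x: for a prime p | d, p x has denominator d / p, so it
    lies in Z[alpha], and maximality at p applies. *)
Lemma integral_in_Z_adjoin x :
  (forall p : nat, prime p -> (p%:Z %| n%:Z * m)%Z ->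
     ~~ (p%:Z ^+ 2 %| m ^+ p - m)%Z) ->
  in_ring_of_integers (in_Q_adjoin alpha) x -> in_Z_adjoin alpha x.
Proof.
move=> Hp [xQ]; have [d [g [d0 Dx]]] := in_Q_adjoin_clear_denom xQ.
elim/ltn_ind: d x g d0 Dx {xQ} => d IH x g d0 Dx xA.
have [d1|d1] := leqP d 1.
  exists g; move: Dx; have -> : d = 1%N by lia.
  by rewrite mul1r.
have p_pr := pdiv_prime d1; have /dvdnP[e De] := pdiv_dvd d.
set p := pdiv d in p_pr De.
have p_gt1 := prime_gt1 p_pr.
apply: (adjoin_maximal_at n_gt0 root_binom_expn p_pr (Hp p p_pr) xA).
have e0 : (0 < e)%N by lia.
have lt_ed : (e < d)%N by nia.
have Epx : e%:R * (p%:R * x) = eval_at alpha g by rewrite mulrA -natrM -De.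
have pxA : p%:R * x \in Aint by rewrite rpredM ?rpred_nat.
by have [q Dq] := IH e lt_ed _ g e0 Epx pxA; exists q.
Qed.

Lemma eval_at_Aint g : eval_at alpha g \in Aint.
Proof.
have aA : alpha \in Aint.
  apply: root_monic_Aint f_alpha _ _; first exact: (monic_map _ binom_poly_monic).
  by apply/polyOverP=> i; rewrite coef_map /= intr_int.
elim/poly_ind: g => [|g c IH]; first by rewrite rmorph0 rpred0.
by rewrite rmorphD rmorphM eval_atX eval_atC rpredD ?rpredM // Aint_int.
Qed.

Lemma in_Z_adjoin_integral x : in_Z_adjoin alpha x ->
  in_ring_of_integers (in_Q_adjoin alpha) x.
Proof.
move=> [g ->]; split; last exact: eval_at_Aint.
exists (map_poly intr g), 1; rewrite map_ratr_intr rmorph1 hornerC.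
by rewrite oner_eq0 divr1.
Qed.

(** * Obstructions to maximality *)

Hypothesis maximal : forall x,
  in_ring_of_integers (in_Q_adjoin alpha) x -> in_Z_adjoin alpha x.

(** Used by contradiction: each case below exhibits an integral g(alpha) / p where g has a
    coefficient 1. *)
Lemma maximal_dvdz_coef (p : nat) (g : {poly int}) i : prime p ->
  (size g <= n)%N -> eval_at alpha g / p%:R \in Aint -> (p%:Z %| g`_i)%Z.
Proof.
move=> p_pr sg gA.
have p0 : (p%:R : algC) != 0 by rewrite pnatr_eq0 -lt0n prime_gt0.
have [|q Dq] := @maximal (eval_at alpha g / p%:R).
  split=> //; exists (map_poly intr g), (p%:R)%:P.
  by rewrite map_ratr_intr map_polyC hornerC /= ratr_nat.
apply: (@dvdz_coef_eval_at p g q) => //.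
by rewrite -[eval_at alpha q]Dq mulrC divfK.
Qed.

(* If [p^2 | m], then [alpha^(n-1) / p] is integral: its [n]-th power is
   [m^(n-1) / p^n]. *)
Lemma maximal_sq_dvd_const (p : nat) : (1 < n)%N -> prime p ->
  ~~ (p%:Z ^+ 2 %| m)%Z.
Proof.
move=> n_gt1 p_pr; apply/negP=> /dvdzP[c Dc].
have p0 : (p%:R : algC) != 0 by rewrite pnatr_eq0 -lt0n prime_gt0.
suff : (p%:Z %| ('X^(n.-1) : {poly int})`_n.-1)%Z.
  rewrite coefXn eqxx dvdz1 /= => /eqP p1.
  by move: (prime_gt1 p_pr); rewrite p1.
apply: maximal_dvdz_coef => //; first by rewrite size_polyXn prednK.
set x := _ / _.
(* This is m^(n-1) / p^n for m = c p^2; the exponent 2 (n - 1) - n is nonnegative as n >= 2. *)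
pose b : int := p%:Z ^+ (n - 2) * c ^+ n.-1.
apply: (root_monic_Aint _ (monicXnsubC b%:~R n_gt0)).
  apply/rootP; rewrite hornerD hornerN hornerXn hornerC.
  apply/eqP; rewrite subr_eq0 /x expr_div_n -rmorphXn -exprM mulnC exprM.
  rewrite rmorphXn (eval_at_Xn root_binom_expn) eval_atC.
  rewrite -(inj_eq (mulIf (expf_neq0 n p0))) divfK ?expf_neq0 //.
  rewrite pmulrn -!rmorphXn -rmorphM eqr_int /b Dc exprMn -exprM.
  have -> : (2 * n.-1 = n - 2 + n)%N by lia.
  by apply/eqP; rewrite exprD rmorphXn /=; ring.
have -> : 'X^n - (b%:~R)%:P = map_poly intr ('X^n - b%:P) :> {poly algC}.
  by rewrite rmorphB /= map_polyXn map_polyC.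
by apply/polyOverP=> i; rewrite coef_map /= intr_int.
Qed.

(* Let [B = alpha^(n/p)] and [T = B - m].  If [m^p - m = c p^2], then
   [S = (B^p - m^p) / T] has the form [T^(p-1) + p m h], so [th = S / p] satisfies
   [T th = - c p] and hence [th^2 = m h th - c T^(p-2)]: it is integral, although
   [S] has a coefficient [1]. *)
Lemma maximal_sq_dvd_fermat (p : nat) : prime p -> (p %| n)%N ->
  ~~ (p%:Z ^+ 2 %| m ^+ p - m)%Z.
Proof.
move=> p_pr /dvdnP[l Dn]; apply/negP=> /dvdzP[c Dc].
have p_gt1 := prime_gt1 p_pr.
have l0 : (0 < l)%N by move: n_gt0; rewrite Dn; case: (l).
have p0 : (p%:R : algC) != 0 by rewrite pnatr_eq0 -lt0n prime_gt0.
pose B : {poly int} := 'X^l; pose T := B - m%:P.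
have T_monic : T \is monic by apply: monicXnsubC.
pose S := \sum_(i < p) B ^+ (p.-1 - i) * m%:P ^+ i.
have DTS : T * S = B ^+ p - m%:P ^+ p by rewrite subrXX.
have [h Dh] := exprD_prime T m%:P p_pr.
have DS : S = T ^+ p.-1 + p%:R * (m%:P * h).
  apply: (mulfI (monic_neq0 T_monic)).
  rewrite DTS mulrDr -exprS prednK ?prime_gt0 //.
  by rewrite -[in LHS](subrK m%:P B) -/T Dh; ring.
have sizeBi (i : 'I_p) (a : int) : (size (B ^+ (p.-1 - i) * a%:P)%R <= n)%N.
  rewrite [_ * a%:P]mulrC mul_polyC (leq_trans (size_scale_leq _ _)) //.
  by rewrite -exprM size_polyXn Dn; have := ltn_ord i; nia.
suff : (p%:Z %| S`_(l * p.-1))%Z.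
  (* Only the term i = 0, which is X^(l (p-1)), reaches this degree. *)
  rewrite /S coef_sum; case: (p) p_gt1 => [|k] //= p_gt1.
  rewrite big_ord_recl /= subn0 expr0 mulr1 -exprM coefXn eqxx big1 ?addr0.
    by rewrite dvdz1 /= => /eqP k0; move: p_gt1; rewrite k0.
  move=> i _; rewrite /bump add1n -rmorphXn -exprM mulrC coefCM coefXn.
  by rewrite gtn_eqF ?mulr0 // ltn_pmul2l //; have := ltn_ord i; lia.
apply: maximal_dvdz_coef => //.
  apply: (big_ind (fun s : {poly int} => (size s <= n)%N)) => [|s t hs ht|i _].
  - by rewrite size_poly0.
  - by rewrite (leq_trans (size_polyD _ _)) // geq_max hs.
  - by rewrite -rmorphXn; apply: sizeBi.
set th := _ / _.
(* T S takes the value m - m^p = - c p^2 at alpha. *)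
have DTth : eval_at alpha T * th = - (c * p%:Z)%:~R.
  apply: (mulIf p0); rewrite /th mulrA divfK // -rmorphM DTS.
  rewrite /B -exprM -Dn -polyC_exp rmorphB (eval_at_Xn root_binom_expn).
  rewrite !eval_atC -intrB -opprB intrN Dc mulNr pmulrn -intrM.
  by rewrite expr2 mulrA.
have Dth2 : th ^+ 2 =
    eval_at alpha (m%:P * h) * th - eval_at alpha (c%:P * T ^+ (p - 2)).
  have Dth : th = eval_at alpha (T ^+ p.-1) / p%:R + eval_at alpha (m%:P * h).
    by rewrite /th DS rmorphD rmorphM rmorph_nat; field.
  have -> : th ^+ 2 =
      th * eval_at alpha (m%:P * h) + th * (eval_at alpha (T ^+ p.-1) / p%:R).
    by rewrite expr2 {2}Dth; ring.
  rewrite mulrC; congr (_ + _).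
  have -> : eval_at alpha (T ^+ p.-1)
      = eval_at alpha T * eval_at alpha (T ^+ (p - 2)).
    by rewrite -rmorphM -exprS; congr (eval_at _ (_ ^+ _)); lia.
  rewrite rmorphM eval_atC.
  transitivity (eval_at alpha T * th * (eval_at alpha (T ^+ (p - 2)) / p%:R)).
    by ring.
  by rewrite DTth intrM -pmulrn; field.
apply/Aint_integralOver.
(* The coefficients of [P] lie in Z[alpha]; integrality over Z follows by transitivity. *)
pose P := 'X^2 - (eval_at alpha (m%:P * h)) *: 'X
  + (eval_at alpha (c%:P * T ^+ (p - 2)))%:P.
have P_int : {in P : seq algC, integralRange (intr : int -> algC)}.
  apply/integral_poly => i; apply/Aint_integralOver; move: i; apply/polyOverP.
  rewrite rpredD ?rpredB ?rpredX ?polyOverX // ?polyOverC ?eval_at_Aint //.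
  by rewrite polyOverZ ?polyOverX ?eval_at_Aint.
apply: (@integral_root_monic _ _ _ th P) => //.
- rewrite monicE /P -addrA lead_coefDl ?lead_coefXn //.
  rewrite size_polyXn ltnS (leq_trans (size_polyD _ _)) // geq_max size_polyN.
  rewrite (leq_trans (size_scale_leq _ _)) ?size_polyX //.
  by rewrite (leq_trans (size_polyC_leq1 _)).
- apply/rootP; rewrite /P !(hornerD, hornerN, hornerZ, hornerXn, hornerC, hornerX).
  by rewrite Dth2; ring.
Qed.

End IrreducibleBinomial.

Theorem theorem4p2 (n : nat) (m : int) (alpha : algC)
  (n_ge2 : (2 <= n)%N)
  (f_irr : irreducible_poly (map_poly intr (binom_poly n m) : {poly rat}))
  (m_val : forall p : nat, prime p -> (padic_val p m%:~R < (n%:Z)%:E)%E)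
  (f_alpha : root (map_poly intr (binom_poly n m)) alpha) :
  (forall x : algC,
     in_Z_adjoin alpha x <-> in_ring_of_integers (in_Q_adjoin alpha) x)
  <->
  (forall p : nat, prime p -> (p%:Z %| n%:Z * m)%Z ->
     padic_val p (m ^+ p - m)%:~R = 1%:E).
Proof.
have n_gt0 : (0 < n)%N by apply: ltnW.
split=> [H p p_pr pnm | H x].
  apply/(padic_val_int_eq1 _ p_pr); rewrite fermat_int //=.
  have maxl x := (H x).2.
  have [pm|pm] := boolP (p%:Z %| m)%Z; last first.
    apply: (maximal_sq_dvd_fermat n_gt0 f_irr f_alpha maxl) => //.
    by move: pnm; rewrite Gauss_dvdzl // coprimezE prime_coprime.
  (* Here p^2 | m^2 | m^p, so p^2 divides m^p - m exactly when it divides m. *)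
  apply: contra (maximal_sq_dvd_const n_gt0 f_irr f_alpha maxl n_ge2 p_pr).
  have p_gt1 := prime_gt1 p_pr.
  rewrite rpredBl //; apply: (@dvdz_trans (m ^+ 2)).
    exact: dvdz_exp2r.
  exact: dvdz_exp2l.
split=> [|]; first exact: (in_Z_adjoin_integral n_gt0 f_alpha).
apply: (integral_in_Z_adjoin n_gt0 f_irr f_alpha) => p p_pr pnm.
by have /(padic_val_int_eq1 _ p_pr)/andP[] := H p p_pr pnm.
Qed.
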